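(* Let $\mathcal P$ be the family of triangles inscribed in a given circle and circumscribed about a given central conic $\mathcal D$. Then the total area of the three power circles of a triangle in $\mathcal P$ is invariant throughout the family if and only if the circumcenter of the triangles coincides either with the center or with a focus of $\mathcal D$. In particular, suppose the circumcircle is the unit circle $\mathbb T=\{z\in\mathbb C:|z|=1\}$, let $a_1,a_2\in\mathbb C$ denote the foci of $\mathcal D$, and let $\mathcal C_1,\mathcal C_2,\mathcal C_3$ be the power circles of a triangle in $\mathcal P$. Then $$\operatorname{Area}(\mathcal C_1)+\operatorname{Area}(\mathcal C_2)+\operatorname{Area}(\mathcal C_3)=\frac{3\pi}{4}\,(9-|a_1|^4)$$ whenever the circumcenter coincides with the center of $\mathcal D$, and $$\operatorname{Area}(\mathcal C_1)+\operatorname{Area}(\mathcal C_2)+\operatorname{Area}(\mathcal C_3)=\frac{3\pi}{4}\,(9-|a_1|^2)$$ whenever the circumcenter coincides with the focus $a_2$.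
   Context: The plane is identified with $\mathbb C$. A central conic is an ellipse or a hyperbola. A triangle is circumscribed about a conic if each of its three side lines is tangent to the conic. The power circles of a triangle are the three circles each passing through a vertex of the triangle and centered at the midpoint of the opposite side; the area of a circle means the area of the disk it bounds. The family $\mathcal P$ consists of all such triangles and is assumed nonempty. *)

(* Defs.v *)
From HB Require Import structures.
From mathcomp Require Import all_boot all_order all_algebra.
From mathcomp Require Import all_classical all_reals all_analysis.
From mathcomp Require Import complex.

Set Implicit Arguments.
Unset Strict Implicit.
Unset Printing Implicit Defensive.

Import Order.TTheory GRing.Theory Num.Theory.
Import numFieldNormedType.Exports.

Local Open Scope classical_set_scope.
Local Open Scope ring_scope.
Local Open Scope complex_scope.

Section PlaneGeometry.
Context {R : realType}.
Local Notation C := R[i].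

(* The R-valued modulus; the generic norm `|z| on R[i] is R[i]-valued. *)
Definition modulus (z : C) : R := ComplexField.Normc.normc z.

Definition midpoint (p q : C) : C := (p + q) / 2.

Definition circle (c : C) (r : R) : set C := [set z | modulus (z - c) = r].

Definition disk (c : C) (r : R) : set C := [set z | modulus (z - c) <= r].

Definition line (p v : C) : set C := [set z | exists t : R, z = p + t%:C * v].

Definition area (A : set C) : \bar R :=
  (lebesgue_measure \x lebesgue_measure)%E
    [set p : R * R | A (p.1 +i* p.2)].

(* The focal loci with foci [a1] and [a2].  The two foci of an ellipse may
   coincide (a circle); the strict inequalities exclude degenerate conics. *)
Definition is_ellipse (D : set C) (a1 a2 : C) : Prop :=
  exists l : R, modulus (a1 - a2) < l /\
    D = [set z | modulus (z - a1) + modulus (z - a2) = l].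

Definition is_hyperbola (D : set C) (a1 a2 : C) : Prop :=
  exists l : R, 0 < l < modulus (a1 - a2) /\
    D = [set z | `|modulus (z - a1) - modulus (z - a2)| = l].

Definition central_conic (D : set C) (a1 a2 : C) : Prop :=
  is_ellipse D a1 a2 \/ is_hyperbola D a1 a2.

Definition conic_center (a1 a2 : C) : C := midpoint a1 a2.

(* The derivative of a plane curve is taken coordinatewise, R[i] carrying no
   canonical normed R-module structure. *)
Definition velocity (g : R -> C) (t : R) (v : C) : Prop :=
  is_derive t (1 : R) (fun s => complex.Re (g s)) (complex.Re v) /\
  is_derive t (1 : R) (fun s => complex.Im (g s)) (complex.Im v).

(* Tangency at a finite point: the asymptotes of a hyperbola, and the lines
   parallel to an asymptote, are not tangent to it. *)
Definition tangent_line (D L : set C) : Prop :=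
  exists (g : R -> C) (v : C),
    [/\ forall t, D (g t), velocity g 0 v, v != 0 & L = line (g 0) v].

Definition collinear (p q r : C) : Prop :=
  exists (c v : C), [/\ line c v p, line c v q & line c v r].

Definition triangle : Type := (C * C * C)%type.

Definition nondegenerate (T : triangle) : Prop :=
  let: (z1, z2, z3) := T in ~ collinear z1 z2 z3.

Definition inscribed (T : triangle) (K : set C) : Prop :=
  let: (z1, z2, z3) := T in [/\ K z1, K z2 & K z3].

Definition circumscribed (T : triangle) (D : set C) : Prop :=
  let: (z1, z2, z3) := T in
  [/\ tangent_line D (line z1 (z2 - z1)),
      tangent_line D (line z2 (z3 - z2)) &
      tangent_line D (line z3 (z1 - z3))].

Definition poncelet_family (K D : set C) : set triangle :=
  [set T | [/\ nondegenerate T, inscribed T K & circumscribed T D]].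

(* The disk bounded by the circle through [v] centered at the midpoint
   of [p] and [q]. *)
Definition power_disk (v p q : C) : set C :=
  disk (midpoint p q) (modulus (v - midpoint p q)).

Definition total_power_area (T : triangle) : \bar R :=
  let: (z1, z2, z3) := T in
  (area (power_disk z1 z2 z3) + area (power_disk z2 z3 z1) +
   area (power_disk z3 z1 z2))%E.

End PlaneGeometry.

(* Main.v *)
Require Import Defs.
From mathcomp Require Import all_boot all_order all_algebra.
From mathcomp Require Import all_classical all_reals all_analysis.
From mathcomp Require Import complex ring lra.

Set Implicit Arguments.
Unset Strict Implicit.
Unset Printing Implicit Defensive.

Import Order.TTheory GRing.Theory Num.Theory.
Import numFieldNormedType.Exports.

(** The area of a power circle is pi times the square of a median, so in a circle of center c
and radius r the total area is 3 pi / 4 * (9 r^2 - r^2 |s|^2), where s is the sum of the vertices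
u, v, w rescaled to the unit circle. With a1, a2 the rescaled foci, tangency of the line uv to
the conic says that the product of the distances from the foci to the line is prescribed, which is
a symmetric polynomial relation, quadratic in v for fixed u. Its two roots v, w satisfy
vw = (u - a1)(u - a2) / ((1 - a1^* u)(1 - a2^* u)), hence u, v, w are the three roots of
z(z - a1)(z - a2) = l (1 - a1^* z)(1 - a2^* z) with l = uvw, and s = a1 + a2 + l (a1 a2)^*.
If a1 + a2 = 0, a1 = 0 or a2 = 0, then |s| does not depend on the unit number l. Otherwise |s| is
a nonconstant function of l; moving a vertex of one given triangle slightly along the circle
yields triangles of the family for infinitely many l, so |s| is not constant. *)

Local Open Scope classical_set_scope.
Local Open Scope ring_scope.

(** * Chords of the unit circle *)

Section PonceletAlgebra.
Variable F : fieldType.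
Implicit Types a b u v k l : F.

(* When [b = a^*] and [u], [v] are unit, [chord a b u v] vanishes exactly when [a] is on the
   line [uv], and is proportional to the signed distance from [a] to that line. *)
Definition chord a b u v := a + u * v * b - u - v.

Lemma chordC a b u v : chord a b u v = chord a b v u.
Proof. by rewrite /chord; ring. Qed.

(** For fixed [u] the tangency relation is a quadratic in [v] with constant term
    [(u - a1) * (u - a2)] and leading coefficient [(1 - b1 * u) * (1 - b2 * u)]. This is Vieta's
    formula for the product of its roots; [k] enters only the middle coefficient. *)
Lemma tangent_chords_product a1 b1 a2 b2 k u v w : v != w ->
  chord a1 b1 u v * chord a2 b2 u v = k * (u * v) ->
  chord a1 b1 u w * chord a2 b2 u w = k * (u * w) ->
  (u - a1) * (u - a2) = (1 - b1 * u) * (1 - b2 * u) * (v * w).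
Proof.
rewrite /chord => vw ev ew; apply/eqP; rewrite -subr_eq0.
have vw0 : v - w != 0 by rewrite subr_eq0.
rewrite -(mulrI_eq0 _ (mulfI vw0)); apply/eqP.
transitivity (v * (k * (u * w)) - w * (k * (u * v))); last by ring.
by rewrite -ev -ew; ring.
Qed.

Lemma cubic_vieta a1 b1 a2 b2 l u v w :
  u != v -> v != w -> u != w ->
  u * ((u - a1) * (u - a2)) = l * ((1 - b1 * u) * (1 - b2 * u)) ->
  v * ((v - a1) * (v - a2)) = l * ((1 - b1 * v) * (1 - b2 * v)) ->
  w * ((w - a1) * (w - a2)) = l * ((1 - b1 * w) * (1 - b2 * w)) ->
  u + v + w = a1 + a2 + l * (b1 * b2) /\
  u * v + (u + v) * w = a1 * a2 + l * (b1 + b2).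
Proof.
move=> uv vw uw eu ev ew.
pose A := a1 + a2 + l * (b1 * b2); pose B := a1 * a2 + l * (b1 + b2).
(* The cubic is [z^3 - A z^2 + B z - l]; its divided difference at two roots vanishes. *)
have H x y : x != y ->
  x * ((x - a1) * (x - a2)) = l * ((1 - b1 * x) * (1 - b2 * x)) ->
  y * ((y - a1) * (y - a2)) = l * ((1 - b1 * y) * (1 - b2 * y)) ->
  B = A * (x + y) - (x ^+ 2 + x * y + y ^+ 2).
  move=> xy ex ey; have xy0 : x - y != 0 by rewrite subr_eq0.
  apply: (mulfI xy0); apply/eqP; rewrite -subr_eq0; apply/eqP.
  transitivity ((x * ((x - a1) * (x - a2)) - l * ((1 - b1 * x) * (1 - b2 * x)))
    - (y * ((y - a1) * (y - a2)) - l * ((1 - b1 * y) * (1 - b2 * y)))).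
    by rewrite /A /B; ring.
  by rewrite ex ey !subrr.
have h1 := H _ _ uv eu ev; have h2 := H _ _ uw eu ew.
have eA : u + v + w = A.
  have vw0 : v - w != 0 by rewrite subr_eq0.
  apply: (mulfI vw0); apply/eqP; rewrite -subr_eq0; apply/eqP.
  transitivity (A * (u + w) - (u ^+ 2 + u * w + w ^+ 2) -
    (A * (u + v) - (u ^+ 2 + u * v + v ^+ 2))); first by ring.
  by rewrite -h1 -h2 subrr.
by split=> //; rewrite -/B h1 -eA; ring.
Qed.

(** The difference of the two sides is a polynomial combination of the two Vieta relations. It
    serves both to compute [k] on a given triangle and to prove tangency of constructed ones. *)
Lemma vieta_tangent a1 b1 a2 b2 u v w :
  u + v + w = a1 + a2 + u * v * w * (b1 * b2) ->
  u * v + (u + v) * w = a1 * a2 + u * v * w * (b1 + b2) ->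
  chord a1 b1 u v * chord a2 b2 u v =
    (1 - a1 * b1) * (1 - a2 * b2) * (u * v).
Proof.
move=> e1 e2; apply/eqP; rewrite -subr_eq0 /chord; apply/eqP.
transitivity ((a1 * a2 + u * v * w * (b1 + b2) - (u * v + (u + v) * w))
    * (1 - u * v * (b1 * b2))
  + (a1 + a2 + u * v * w * (b1 * b2) - (u + v + w))
    * (u * v * (b1 + b2) - (u + v))); first by ring.
by rewrite e1 e2 !subrr !mul0r addr0.
Qed.

End PonceletAlgebra.

(** * Unit complex numbers and quadratics with unit roots *)

Section UnitCircle.
Variable C : numClosedFieldType.
Implicit Types a u v w z : C.

Lemma unit_neq0 u : `|u| = 1 -> u != 0.
Proof. by move=> u1; rewrite -normr_gt0 u1 ltr01. Qed.

Lemma unit_conj u : `|u| = 1 -> u^* = u^-1.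
Proof. by move=> u1; rewrite invC_norm u1 expr1n invr1 mul1r. Qed.

Lemma unit_mulJ u : `|u| = 1 -> u * u^* = 1.
Proof. by move=> u1; rewrite -normCK u1 expr1n. Qed.

(** Blaschke factors are unimodular on the unit circle. *)
Lemma unit_norm_subJ a u : `|u| = 1 -> `|1 - a^* * u| = `|u - a|.
Proof.
move=> u1; transitivity `|(u - a)^* * u|; last first.
  by rewrite normrM norm_conjC u1 mulr1.
by rewrite rmorphB/= mulrBl [u^* * u]mulrC unit_mulJ.
Qed.

(* The inversion [z |-> 1 / z^*] permutes the roots of a self-inversive quadratic; if it
   exchanged them, their sum would have modulus at least 2. *)
Lemma quadratic_unit_roots s p : `|p| = 1 -> s^* * p = s -> `|s| < 2 ->
  exists v w, [/\ `|v| = 1, `|w| = 1, v + w = s, v * w = p & v != w].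
Proof.
move=> p1 sp s2.
have [d dE] : exists d, d ^+ 2 = s ^+ 2 - 4 * p by exists (sqrtC (s ^+ 2 - 4 * p)); rewrite sqrtCK.
have n2 : (2 : C) != 0 by rewrite pnatr_eq0.
pose v := (s + d) / 2; pose w := (s - d) / 2.
have vwE : v + w = s by rewrite /v /w; field.
have vwM : v * w = p.
  transitivity ((s ^+ 2 - d ^+ 2) / 4); first by rewrite /v /w; field.
  by rewrite dE; field.
have vw : v != w.
  apply/eqP => vw; have sv : s = v * 2 by rewrite -vwE -vw; ring.
  have v1 : `|v| ^+ 2 = 1 by rewrite -normrX expr2 {2}vw vwM.
  have : `|v| = 1 by apply/eqP; rewrite -(@pexpr_eq1 _ _ 2) ?v1.
  by move: s2; rewrite sv normrM normr_nat => /[swap] ->; rewrite mul1r ltxx.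
have p0 := unit_neq0 p1.
have v0 : v != 0 by apply/eqP => e0; move: p0; rewrite -vwM e0 mul0r eqxx.
have w0 : w != 0 by apply/eqP => e0; move: p0; rewrite -vwM e0 mulr0 eqxx.
(* The inverse of [v^*] is again a root: the factors correspond to its being [v] or [w]. *)
have key : (v * v^* - 1) * (w * v^* - 1) = 0.
  have vc : v^* != 0 by rewrite conjC_eq0.
  have : v^* * w^* = p^-1 by rewrite -rmorphM vwM /= unit_conj.
  have : (v^* + w^*) * p = v + w by rewrite -rmorphD vwE.
  rewrite -vwM => e1 e2.
  have wE : w^* = (v * w * v^*)^-1.
    by apply: (mulfI vc); rewrite e2; field; rewrite v0 w0 vc.
  move: e1; rewrite wE => e1.
  transitivity ((v^* + (v * w * v^*)^-1) * (v * w) * v^* - (v + w) * v^*); last by rewrite e1 subrr.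
  by field; rewrite v0 w0 vc.
have v1 : `|v| = 1.
  move/eqP: key; rewrite mulf_eq0 => /orP[]; rewrite subr_eq0.
    by rewrite -normCK pexpr_eq1 ?normr_ge0 // => /eqP.
  move=> /eqP wv.
  have vc : v^* != 0 by rewrite conjC_eq0.
  have wE : w = (v^*)^-1 by apply: (mulIf vc); rewrite wv mulVf.
  have wE2 : w = v / `|v| ^+ 2.
    by rewrite wE normCK; field; rewrite vc v0.
  have nv0 : 0 < `|v| by rewrite normr_gt0.
  have : `|s| = `|v| + `|v|^-1.
    have -> : s = v * (1 + (`|v| ^+ 2)^-1) by rewrite -vwE wE2 mulrDr mulr1.
    rewrite normrM [X in _ * X]ger0_norm; last first.
      by rewrite addr_ge0 ?ler01 // invr_ge0 exprn_ge0.
    by field; rewrite gt_eqF.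
  move: s2 => /[swap] ->.
  rewrite -subr_lt0 => H; suff: 0 <= `|v| + `|v|^-1 - 2 by move=> /le_lt_trans /(_ H); rewrite ltxx.
  have -> : `|v| + `|v|^-1 - 2 = (`|v| - 1) ^+ 2 / `|v| by field; rewrite gt_eqF.
  by rewrite divr_ge0 ?real_exprn_even_ge0 // realB ?normr_real ?real1.
have w1 : `|w| = 1.
  by move: p1; rewrite -vwM normrM v1 mul1r.
by exists v, w; split.
Qed.

End UnitCircle.

(** * Avoiding roots and keeping strict inequalities near a point of the unit circle *)

Section Perturbation.
Variable C : numClosedFieldType.
Implicit Types a u v w z k e : C.

Definition cayley (t : C) := (1 + 'i * t) / (1 - 'i * t).

Section Cayley.
Variable t : C.
Hypothesis tR : t \is Num.real.

Let normS : `|1 - 'i * t| ^+ 2 = 1 + t ^+ 2.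
Proof.
rewrite normCK rmorphB rmorphM rmorph1 /= conjCi (CrealP tR).
by rewrite mulNr opprK -subr_sqr expr1n exprMn sqrCi mulN1r opprK.
Qed.

Let norm_ge1 : 1 <= `|1 - 'i * t|.
Proof.
by rewrite -(@expr_ge1 _ 2) // normS lerDl real_exprn_even_ge0.
Qed.

Lemma cayley_den_neq0 : 1 - 'i * t != 0.
Proof. by rewrite -normr_gt0 (lt_le_trans ltr01). Qed.

Lemma norm_cayley : `|cayley t| = 1.
Proof.
rewrite /cayley normf_div -[`|1 + _|]norm_conjC rmorphD rmorphM rmorph1 /= conjCi.
by rewrite (CrealP tR) mulNr divff // normr_eq0 cayley_den_neq0.
Qed.

Lemma cayley_near1 : `|cayley t - 1| <= 2 * `|t|.
Proof.
have -> : cayley t - 1 = 2 * 'i * t / (1 - 'i * t).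
  by rewrite /cayley; field; exact: cayley_den_neq0.
rewrite normf_div !normrM normCi mulr1 normr_nat ler_pdivrMr ?(lt_le_trans ltr01) //.
by rewrite ler_peMr // mulr_ge0 ?ler0n.
Qed.
End Cayley.

Lemma cayley_inj : {in Num.real &, injective cayley}.
Proof.
move=> s t sR tR /eqP; rewrite /cayley eqr_div ?cayley_den_neq0 // => /eqP E.
have i2 : 2 * 'i != 0 :> C by rewrite mulf_neq0 ?pnatr_eq0 ?neq0Ci.
apply: (mulfI i2); apply/eqP; rewrite -subr_eq0; apply/eqP.
transitivity ((1 + 'i * s) * (1 - 'i * t) - (1 + 'i * t) * (1 - 'i * s)); first by ring.
by rewrite E subrr.
Qed.

(** Among [size p] distinct unit numbers close to [u], one is not a root of [p]. *)
Lemma unit_nonroot (p : {poly C}) u e : p != 0 -> `|u| = 1 -> 0 < e ->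
  exists w, [/\ `|w| = 1, `|w - u| < e & p.[w] != 0].
Proof.
(* The denominator exceeds 2 already at [n = 0], which absorbs the factor 2 of [cayley_near1]
   strictly. *)
move=> p0 u1 e0; pose t n : C := e / (n.+3)%:R.
have tR n : t n \is Num.real by rewrite realM ?realV ?realn ?gtr0_real.
pose rs := [seq u * cayley (t n) | n <- iota 0 (size p)].
have uqrs : uniq rs.
  rewrite map_inj_uniq ?iota_uniq // => m n /(mulfI (unit_neq0 u1)).
  move=> /(cayley_inj (tR m) (tR n)) /(mulfI (lt0r_neq0 e0)) /invr_inj /eqP.
  by rewrite eqr_nat => /eqP [].
have : ~~ all (root p) rs.
  apply/negP => /(max_poly_roots p0) /(_ uqrs).
  by rewrite size_map size_iota ltnn.
case/allPn => w /mapP[n _ ->]; rewrite rootE => pw.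
exists (u * cayley (t n)); split=> //; first by rewrite normrM u1 norm_cayley ?mulr1.
rewrite -[X in _ - X]mulr1 -mulrBr normrM u1 mul1r.
apply: le_lt_trans (cayley_near1 (tR n)) _.
rewrite ger0_norm ?divr_ge0 ?(ltW e0) ?ler0n // mulrA ltr_pdivrMr ?ltr0Sn //.
by rewrite mulrC ltr_pM2l // ltr_nat.
Qed.

(** Divide [p - p(u)] by [X - u]; on the unit circle the quotient is bounded by the sum of the
    moduli of its coefficients. *)
Lemma horner_unit_lipschitz (p : {poly C}) u : exists2 M, 0 <= M &
  forall w, `|w| = 1 -> `|p.[w] - p.[u]| <= M * `|w - u|.
Proof.
have /factor_theorem[q qE] : root (p - p.[u]%:P) u by rewrite rootE !hornerE subrr.
exists (\sum_(i < size q) `|q`_i|); first exact: sumr_ge0.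
move=> w w1; have -> : p.[w] - p.[u] = (p - p.[u]%:P).[w] by rewrite !hornerE.
rewrite qE hornerM normrM !hornerE ler_wpM2r // horner_coef.
apply: le_trans (ler_norm_sum _ _ _) _; apply: ler_sum => i _.
by rewrite normrM normrX w1 expr1n mulr1.
Qed.

Lemma unit_open_lt (p q : {poly C}) u : `|p.[u]| < `|q.[u]| ->
  exists2 e, 0 < e & forall w, `|w| = 1 -> `|w - u| < e -> `|p.[w]| < `|q.[w]|.
Proof.
move=> pq.
have [M M0 HM] := horner_unit_lipschitz p u.
have [N N0 HN] := horner_unit_lipschitz q u.
have MN : 0 < M + N + 1 by rewrite ltr_wpDl ?addr_ge0.
(* The summand 1 keeps the denominator positive when both Lipschitz constants are 0. *)
exists ((`|q.[u]| - `|p.[u]|) / (M + N + 1)); first by rewrite divr_gt0 ?subr_gt0.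
move=> w w1; rewrite ltr_pdivlMr // mulrC => wu.
have hp : `|p.[w]| <= `|p.[u]| + M * `|w - u|.
  apply: le_trans (_ : `|p.[u]| + `|p.[w] - p.[u]| <= _); last by rewrite lerD2l HM.
  by rewrite -[X in `|X| <= _](subrKC p.[u]) ler_normD.
have hq : `|q.[u]| <= `|q.[w]| + N * `|w - u|.
  apply: le_trans (_ : `|q.[w]| + `|q.[u] - q.[w]| <= _).
    by rewrite -[X in `|X| <= _](subrKC q.[w]) ler_normD.
  by rewrite lerD2l distrC HN.
rewrite -(ltrD2r (N * `|w - u|)); apply: lt_le_trans hq.
apply: le_lt_trans (_ : _ <= `|p.[u]| + (M * `|w - u| + N * `|w - u|)) _.
  by rewrite addrA lerD2r.
rewrite -ltrBrDl; apply: le_lt_trans wu.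
by rewrite !mulrDl mul1r lerDl.
Qed.
End Perturbation.

(** * Poncelet triangles in the unit circle *)

Section UnitTriangles.
Variable C : numClosedFieldType.
Implicit Types a u v w z k e : C.

Lemma unit_norm_add_lt2 u v : `|u| = 1 -> `|v| = 1 -> u != v -> `|u + v| < 2.
Proof.
move=> u1 v1 uv; rewrite -(ltr_pXn2r (n := 2)) ?nnegrE ?normr_ge0 ?ler0n //.
have -> : `|u + v| ^+ 2 = 2 ^+ 2 - `|u - v| ^+ 2.
  rewrite !normCK !rmorphD rmorphN /=.
  transitivity (2 * (u * u^* + v * v^*) - (u - v) * (u^* - v^*)); first by ring.
  by rewrite !unit_mulJ //; ring.
by rewrite gtrDl oppr_lt0 exprn_gt0 // normr_gt0 subr_eq0.
Qed.

(* The first condition says that the product of the signed distances from the foci to the line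
   [uv] is the one prescribed by the conic; the second excludes lines through the center, that
   is, asymptotes. *)
Definition tangent_chord k a1 a2 u v : Prop :=
  chord a1 a1^* u v * chord a2 a2^* u v = k * (u * v) /\
  chord a1 a1^* u v + chord a2 a2^* u v != 0.

(** The rescaled form of membership in the family; on a circle, distinctness of the vertices amounts
    to nondegeneracy. *)
Definition unit_triangle k a1 a2 u v w : Prop :=
  [/\ [/\ `|u| = 1, `|v| = 1 & `|w| = 1], [/\ u != v, v != w & w != u],
      tangent_chord k a1 a2 u v, tangent_chord k a1 a2 v w & tangent_chord k a1 a2 w u].

(** The product formula at each vertex makes it a root of the cubic with [l = u * v * w], so
    [cubic_vieta] applies and [vieta_tangent] then determines [k]. *)
Lemma unit_triangle_vieta k a1 a2 u v w : k != 0 -> unit_triangle k a1 a2 u v w ->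
  [/\ u + v + w = a1 + a2 + u * v * w * (a1^* * a2^*),
      (u - a1) * (u - a2) = (1 - a1^* * u) * (1 - a2^* * u) * (v * w),
      (1 - a1^* * u) * (1 - a2^* * u) != 0 &
      k = (1 - a1 * a1^*) * (1 - a2 * a2^*)].
Proof.
move=> k0 [[u1 v1 w1] [uv vw wu] [tuv _] [tvw _] [twu _]].
have tvu := tuv; rewrite !(chordC _ _ u v) (mulrC u v) in tvu.
have twv := tvw; rewrite !(chordC _ _ v w) (mulrC v w) in twv.
have tuw := twu; rewrite !(chordC _ _ w u) (mulrC w u) in tuw.
have eu := tangent_chords_product vw tuv tuw.
have ev := tangent_chords_product wu tvw tvu.
have ew := tangent_chords_product uv twu twv.
have [||||||s1 s2] := @cubic_vieta _ a1 a1^* a2 a2^* (u * v * w) u v w => //.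
- by rewrite eq_sym.
- by rewrite eu; ring.
- by rewrite ev; ring.
- by rewrite ew; ring.
have uv0 : u * v != 0 by rewrite mulf_neq0 ?unit_neq0.
split=> //; last by apply: (mulIf uv0); rewrite -tuv (vieta_tangent s1 s2).
(* A vanishing denominator would put a focus at the vertex [u], hence on the tangent [uv], against
   [k != 0]. *)
have nz a : 1 - a^* * u = 0 -> chord a a^* u v = 0.
  move=> H; have au : a = u.
    by apply/esym/eqP; rewrite -subr_eq0 -normr_eq0 -unit_norm_subJ // H normr0.
  by rewrite /chord au; transitivity (v * (u * u^* - 1)); [ring|rewrite unit_mulJ // subrr mulr0].
have kuv : k * (u * v) != 0 by rewrite mulf_neq0.
by apply: mulf_neq0; apply: contraNneq kuv => /nz H; rewrite -tuv H ?mul0r ?mulr0.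
Qed.

(** Vieta's relations force the vertices other than [w] to have sum [S / D] and product [M / D]. The
    quadratic with these data is self-inversive, so [quadratic_unit_roots] supplies them. That [w]
    differs from both, and that no side passes through the center, is left to the caller. *)
Lemma unit_triangle_construct a1 a2 w :
  let D := (1 - a1^* * w) * (1 - a2^* * w) in
  let M := (w - a1) * (w - a2) in
  let S := (a1 + a2 - w) * D + a1^* * a2^* * (w * M) in
  `|w| = 1 -> D != 0 -> `|S| < `|2 * D| ->
  let k := (1 - a1 * a1^*) * (1 - a2 * a2^*) in
  exists u v, [/\ `|u| = 1, `|v| = 1, u != v, D * (u + v) = S & D * (u * v) = M] /\
    [/\ chord a1 a1^* u v * chord a2 a2^* u v = k * (u * v),
        chord a1 a1^* v w * chord a2 a2^* v w = k * (v * w) &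
        chord a1 a1^* w u * chord a2 a2^* w u = k * (w * u)].
Proof.
move=> D M S w1 D0 SD k.
have DE : D = (1 - a1^* * w) * (1 - a2^* * w) by [].
have ME : M = (w - a1) * (w - a2) by [].
have SE : S = (a1 + a2 - w) * D + a1^* * a2^* * (w * M) by [].
clearbody S M D.
have w0 := unit_neq0 w1.
have Dn : `|D| = `|M| by rewrite DE ME !normrM !unit_norm_subJ.
have nD0 : `|D| != 0 by rewrite normr_eq0.
pose p := M / D; pose s := S / D.
have p1 : `|p| = 1 by rewrite normf_div -Dn divff.
have Dc : D^* = M / w ^+ 2.
  rewrite DE ME !(rmorphM, rmorphB, rmorph1) /= !conjCK (unit_conj w1).
  by field.
have Mc : M^* = D / w ^+ 2.
  rewrite DE ME !(rmorphM, rmorphB, rmorph1) /= (unit_conj w1).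
  by field.
have M0 : M != 0 by rewrite -normr_eq0 -Dn normr_eq0.
have Sc : S^* = S / w ^+ 2.
  rewrite [in LHS]SE !(rmorphM, rmorphB, rmorphD) /= !conjCK Dc Mc (unit_conj w1).
  apply: (mulfI (expf_neq0 3 w0)); apply/eqP; rewrite -subr_eq0; apply/eqP.
  transitivity (D * ((w - a1) * (w - a2)) - M * ((1 - a1^* * w) * (1 - a2^* * w))).
    by rewrite SE; field.
  by rewrite -DE -ME mulrC subrr.
have sp : s^* * p = s.
  rewrite /s /p fmorph_div /= Sc Dc; field.
  by rewrite D0 w0 M0.
have s2 : `|s| < 2.
  have Dgt0 : 0 < `|D| by rewrite normr_gt0.
  by rewrite normf_div ltr_pdivrMr //; move: SD; rewrite normrM normr_nat.
have [u [v [u1 v1 uvs uvp uv]]] := quadratic_unit_roots p1 sp s2.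
have Ds : D * (u + v) = S by rewrite uvs /s mulrC divfK.
have Dp : D * (u * v) = M by rewrite uvp /p mulrC divfK.
have s1 : u + v + w = a1 + a2 + u * v * w * (a1^* * a2^*).
  apply: (mulfI D0); rewrite mulrDr Ds.
  transitivity (D * (a1 + a2) + w * M * (a1^* * a2^*)); first by rewrite SE; ring.
  by rewrite -Dp; ring.
have s2' : u * v + (u + v) * w = a1 * a2 + u * v * w * (a1^* + a2^*).
  apply: (mulfI D0); rewrite mulrDr Dp mulrA Ds.
  transitivity (D * (a1 * a2) + w * M * (a1^* + a2^*)); last by rewrite -Dp; ring.
  by rewrite SE DE ME; ring.
exists u, v; split=> //; split.
- exact: vieta_tangent s1 s2'.
- apply: (@vieta_tangent _ _ _ _ _ v w u).
    by transitivity (u + v + w); [ring|rewrite s1; ring].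
  by transitivity (u * v + (u + v) * w); [ring|rewrite s2'; ring].
apply: (@vieta_tangent _ _ _ _ _ w u v).
  by transitivity (u + v + w); [ring|rewrite s1; ring].
by transitivity (u * v + (u + v) * w); [ring|rewrite s2'; ring].
Qed.

(** With [l] the product of the vertices, the squared modulus of their sum is a constant plus
    [K / l + K^* l]. As [K != 0], this takes a given value for at most two [l], which a suitable
    vertex [w] near [x] avoids. *)
Lemma unit_triangle_perturb k a1 a2 x y z : k != 0 -> unit_triangle k a1 a2 x y z ->
  (a1 + a2) * (a1 * a2) != 0 ->
  exists u v w, unit_triangle k a1 a2 u v w /\ `|u + v + w| ^+ 2 != `|x + y + z| ^+ 2.
Proof.
move=> k0 T K0; have [s1 Mx Dx0 kE] := unit_triangle_vieta k0 T.
case: T => [[x1 y1 z1] [xy yz zx] [_ cxy] [_ cyz] [_ czx]].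
set K := (a1 + a2) * (a1 * a2) in K0 *.
pose c := `|x + y + z| ^+ 2 - (a1 + a2) * (a1^* + a2^*) - a1 * a2 * (a1^* * a2^*).
(* The triangle with vertex [w] is given by rational functions of [w]; all that can go wrong
   for [w] close to [x] is a zero of one of the polynomials [pD], [p2], ..., [p4], and [p5]
   vanishes when the sum of the vertices has the same modulus as for [x], [y], [z]. *)
pose pD : {poly C} := (1 - a1^*%:P * 'X) * (1 - a2^*%:P * 'X).
pose pM : {poly C} := ('X - a1%:P) * ('X - a2%:P).
pose pS : {poly C} := ((a1 + a2)%:P - 'X) * pD + (a1^* * a2^*)%:P * ('X * pM).
pose pA : {poly C} := (a1 + a2)%:P - 2%:P * 'X.
pose pE : {poly C} := 2%:P - (a1^* + a2^*)%:P * 'X.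
(* If [u], [v] are the other vertices, then at [w], up to the factor [pD]: [p2] is
   [(w - u) * (w - v)], [p3] is the sum of the two chords for [uv], and [p4] is the product of such
   sums for [vw] and [wu], each sum being affine in [v] or [u] with coefficients [pA] and [- pE]. *)
pose p2 := pD * 'X^2 - pS * 'X + pM.
pose p3 := pD * (a1 + a2)%:P + pM * (a1^* + a2^*)%:P - 2%:P * pS.
pose p4 := pA ^+ 2 * pD - pA * pE * pS + pE ^+ 2 * pM.
pose p5 := K%:P * pD ^+ 2 + K^*%:P * ('X * pM) ^+ 2 - c%:P * ('X * pM * pD).
have hD w : pD.[w] = (1 - a1^* * w) * (1 - a2^* * w) by rewrite /pD !hornerE.
have hM w : pM.[w] = (w - a1) * (w - a2) by rewrite /pM !hornerE.
have hS w : pS.[w] = (a1 + a2 - w) * pD.[w] + a1^* * a2^* * (w * pM.[w]).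
  by rewrite /pS !(hornerM, hornerD, hornerN, hornerC, hornerX).
have hA w : pA.[w] = a1 + a2 - 2 * w by rewrite /pA !hornerE.
have hE w : pE.[w] = 2 - (a1^* + a2^*) * w by rewrite /pE !hornerE.
clearbody pA pE pS pM pD.
have hMx : pM.[x] = pD.[x] * (y * z) by rewrite hM Mx hD.
have hSx : pS.[x] = pD.[x] * (y + z).
  rewrite hS hMx; transitivity (pD.[x] * ((a1 + a2 + x * y * z * (a1^* * a2^*)) - x)).
    by ring.
  by rewrite -s1; ring.
have Dx : pD.[x] != 0 by rewrite hD.
have nz (p : {poly C}) (t : C) : p.[t] != 0 -> p != 0.
  by apply: contraNneq => ->; rewrite horner0.
have n1 := nz _ _ Dx.
have n2 : p2 != 0.
  apply: (nz _ x); rewrite /p2 !(hornerM, hornerD, hornerN, hornerXn, hornerX) hMx hSx.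
  rewrite (_ : _ + _ = pD.[x] * ((x - y) * (x - z))); last by ring.
  by rewrite !mulf_neq0 ?subr_eq0 // eq_sym.
have n3 : p3 != 0.
  apply: (nz _ x); rewrite /p3 !(hornerM, hornerD, hornerN, hornerC) hMx hSx.
  rewrite (_ : _ - _ = pD.[x] * (chord a1 a1^* y z + chord a2 a2^* y z)).
    by rewrite mulf_neq0.
  by rewrite /chord; ring.
have n4 : p4 != 0.
  apply: (nz _ x); rewrite /p4 !(hornerM, hornerD, hornerN, horner_exp) hMx hSx hA hE.
  rewrite (_ : _ + _ = pD.[x] * ((chord a1 a1^* x y + chord a2 a2^* x y) * (chord a1 a1^* z x + chord a2 a2^* z x))).
    by rewrite !mulf_neq0.
  by rewrite /chord; ring.
have n5 : p5 != 0.
  (* At 0 only the first term survives, with value [K]. *)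
  apply: (nz _ 0); rewrite /p5 !(hornerM, hornerD, hornerN, hornerC, hornerX, horner_exp) hD.
  by rewrite !(mul0r, mulr0, subr0, expr0n, addr0, mulr1, expr1n).
have bad0 : pD * p2 * p3 * p4 * p5 != 0 by rewrite !mulf_neq0.
(* At [x] the inequality reads [|y + z| < 2]. *)
have [e e0 close] : exists2 e, 0 < e & forall w, `|w| = 1 -> `|w - x| < e -> `|pS.[w]| < `|(2%:P * pD).[w]|.
  apply: unit_open_lt => //; rewrite hornerM hornerC hSx mulrC !normrM ltr_pM2r ?normr_gt0 //.
  by rewrite normr_nat unit_norm_add_lt2.
have [w [w1 wx]] := unit_nonroot bad0 x1 e0.
rewrite !hornerM !mulf_eq0 !negb_or => /andP[/andP[/andP[/andP[Dw p2w] p3w] p4w] p5w].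
have := close w w1 wx; rewrite hornerM hornerC.
move: (Dw); rewrite hS hM hD => Dw' SDw.
have [u [v [[u1 v1 uv Ds Dp] [tuv tvw twu]]]] := unit_triangle_construct w1 Dw' SDw.
rewrite -hD -hM -hS in Ds Dp.
have := p2w; rewrite /p2 !(hornerM, hornerD, hornerN, hornerXn, hornerX) -Ds -Dp.
rewrite (_ : _ + _ = pD.[w] * ((w - u) * (v - w)) * -1); last by ring.
rewrite !mulf_eq0 !negb_or !subr_eq0 => /andP[/andP[_ /andP[wu vw]] _].
have := p3w; rewrite /p3 !(hornerM, hornerD, hornerN, hornerC) -Ds -Dp.
rewrite (_ : _ - _ = pD.[w] * (chord a1 a1^* u v + chord a2 a2^* u v)); last by rewrite /chord; ring.
rewrite mulf_eq0 negb_or => /andP[_ cuv].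
have := p4w; rewrite /p4 !(hornerM, hornerD, hornerN, horner_exp) -Ds -Dp hA hE.
rewrite (_ : _ + _ = pD.[w] * ((chord a1 a1^* v w + chord a2 a2^* v w) *
  (chord a1 a1^* w u + chord a2 a2^* w u))); last by rewrite /chord; ring.
rewrite !mulf_eq0 !negb_or => /and3P[_ cvw cwu].
exists u, v, w; split; first by rewrite kE.
apply: contraNneq p5w => sE; apply/eqP.
have T' : unit_triangle k a1 a2 u v w by rewrite kE.
have [s1' _ _ _] := unit_triangle_vieta k0 T'.
set m := u * v * w in s1'.
have m1 : `|m| = 1 by rewrite /m !normrM u1 v1 w1 !mulr1.
have m0 := unit_neq0 m1.
have wM : w * pM.[w] = pD.[w] * m by rewrite -Dp /m; ring.
clearbody m.
have cE : c = K * m^-1 + K^* * m.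
  rewrite /c -sE s1' normCK !(rmorphD, rmorphM) /= !conjCK (unit_conj m1) /K.
  by rewrite ?(rmorphD, rmorphM) /=; field.
rewrite /p5 !(hornerM, hornerD, hornerN, hornerC, horner_exp, hornerX) wM cE.
by field.
Qed.
End UnitTriangles.

Local Open Scope complex_scope.

(** * Area of a disk *)

Section Area.
Variable R : realType.
Implicit Types a r x : R.
Local Notation mu := (@lebesgue_measure R).

(** Substitute [a + r * sin t] for [x], which is increasing on [[-pi/2, pi/2]] when [r > 0]; the
    case [r = 0] is separate. *)
Lemma integral_semicircle a r : 0 <= r ->
  (\int[mu]_(x in `[(a - r)%R, (a + r)%R]) (2 * Num.sqrt (r ^+ 2 - (x - a) ^+ 2))%:E =
   (pi * r ^+ 2)%:E)%E.
Proof.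
rewrite le_eqVlt => /predU1P[<-|r0].
  by rewrite subr0 addr0 set_itv1 integral_set1 expr0n /= mulr0.
have pi2 : 0 < pi / 2 :> R by rewrite divr_gt0 ?pi_gt0.
have Npi2 : - (pi / 2) < pi / 2 :> R by lra.
pose F (t : R) := a + r * sin t.
have dF t : is_derive t (1 : R) F (r * cos t).
  rewrite /F; apply: is_derive_eq.
  by rewrite add0r mul1r.
have F'E : derive1 F = fun t => r * cos t.
  by apply/funext => t; rewrite derive1E derive_val.
have cF' : continuous (fun t : R => r * cos t).
  by move=> t; apply: continuousM; [exact: cst_continuous|exact: continuous_cos].
have cF : continuous F.
  by move=> t; apply/differentiable_continuous/derivable1_diffP; case: (dF t).
have Fl : F (- (pi / 2)) = a - r by rewrite /F sinN sin_pihalf mulrN1.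
have Fr : F (pi / 2) = a + r by rewrite /F sin_pihalf mulr1.
pose G x := 2 * Num.sqrt (r ^+ 2 - (x - a) ^+ 2).
have cG : continuous G.
  rewrite /G => x; apply: cvgM; first exact: cvg_cst.
  apply: (@continuous_comp _ _ _ (fun x => r ^+ 2 - (x - a) ^+ 2) Num.sqrt).
    apply/differentiable_continuous/derivable1_diffP.
    by apply: ex_derive.
  exact: sqrt_continuous.
rewrite -Fl -Fr (integration_by_substitution_increasing (G := G)); first last.
- exact: continuous_subspaceT.
- split=> [t _||]; first by case: (dF t).
    by apply: cvg_at_right_filter; exact: cF.
  by apply: cvg_at_left_filter; exact: cF.
- rewrite F'E; apply/cvg_ex; eexists; apply: cvg_at_left_filter; exact: cF'.
- rewrite F'E; apply/cvg_ex; eexists; apply: cvg_at_right_filter; exact: cF'.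
- by rewrite F'E => t _; exact: cF'.
- move=> x y xI yI xy; rewrite /F ltrD2l ltr_pM2l //.
  by rewrite ltr_sin.
- exact: ltW.
pose H (t : R) := r ^+ 2 * (t + sin t * cos t).
have dH t : is_derive t (1 : R) H (2 * (r * cos t) ^+ 2).
  rewrite /H; apply: is_derive_eq.
  rewrite /GRing.scale /= exprMn; have := cos2Dsin2 t. nra.
transitivity (\int[mu]_(t in `[(- (pi / 2))%R, (pi / 2)%R]) (2 * (r * cos t) ^+ 2)%:E)%E.
  apply: eq_integral => t; rewrite inE /= in_itv /= => tI.
  have ct : 0 <= r * cos t by rewrite mulr_ge0 ?cos_ge0_pihalf // ltW.
  rewrite F'E; congr EFin; rewrite -[LHS]/(G (F t) * (r * cos t)) /G /F addrAC subrr add0r.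
  rewrite (_ : r ^+ 2 - (r * sin t) ^+ 2 = (r * cos t) ^+ 2); last first.
    by rewrite !exprMn cos2sin2 mulrBr mulr1.
  by rewrite sqrtr_sqr ger0_norm // expr2 mulrA.
rewrite (@continuous_FTC2 _ _ H) //.
- rewrite -EFinB /H sinN cosN sin_pihalf cos_pihalf; congr EFin; by field.
- have c2 : continuous (fun t : R => 2 * (r * cos t) ^+ 2).
    move=> t; apply: cvgM; first exact: cvg_cst.
    by apply: cvgM; exact: cF'.
  exact: continuous_subspaceT.
- have cH : continuous H.
    by move=> t; apply/differentiable_continuous/derivable1_diffP; case: (dH t).
  split=> [t _||]; first by case: (dH t).
    by apply: cvg_at_right_filter; exact: cH.
  by apply: cvg_at_left_filter; exact: cH.
- by move=> t _; rewrite derive1E derive_val.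
Qed.

(** Vertical sections are intervals of length [2 * sqrt (r^2 - (x - a)^2)], empty outside
    [[a - r, a + r]]. *)
Lemma area_disk (c : R[i]) r : 0 <= r -> area (disk c r) = (pi * r ^+ 2)%:E.
Proof.
move=> r0; case: c => a b; rewrite -(integral_semicircle a r0).
rewrite /area /product_measure1 [RHS]integral_mkcond.
apply: eq_integral => x _; rewrite patchE mem_setE in_itv /=.
have sE y : disk (a +i* b)%C r (x +i* y)%C <-> (y - b) ^+ 2 <= r ^+ 2 - (x - a) ^+ 2.
  rewrite /disk /modulus /= lerBrDl -[X in _ <= X](ger0_norm r0) -sqrtr_sqr.
  by rewrite ler_sqrt ?sqr_ge0.
have xE : (a - r <= x <= a + r) = (0 <= r ^+ 2 - (x - a) ^+ 2).
  by rewrite subr_ge0 -[RHS]ler_sqrt ?sqr_ge0 // !sqrtr_sqr (ger0_norm r0) ler_distl.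
case: ifPn => [|xI].
  rewrite xE => s0; set s := Num.sqrt _.
  rewrite (_ : xsection _ _ = `[b - s, b + s]%classic).
    rewrite lebesgue_measure_itv /= lte_fin; have : 0 <= s by exact: sqrtr_ge0.
    rewrite le_eqVlt => /predU1P[<-|sp].
      by rewrite subr0 addr0 ltxx mulr0.
    rewrite ifT; last by lra.
    by rewrite -EFinD; congr EFin; lra.
  apply/seteqP; split=> y; rewrite /= in_itv /= -ler_distl /s -sqrtr_sqr ler_sqrt //.
    by move=> /xsectionP /sE.
  by move=> ?; apply/xsectionP/sE.
rewrite (_ : xsection _ _ = set0) ?measure0 //.
rewrite -subset0 => y /xsectionP /= /sE ys; move: xI; rewrite xE => /negP; apply.
exact: le_trans (sqr_ge0 _) ys.
Qed.
End Area.

(** * Tangent lines of a central conic *)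

Section Tangency.
Variable R : realType.
Implicit Types z p v d : R[i].

Lemma modulus_norm z : (modulus z)%:C = `|z|.
Proof. by []. Qed.

Lemma modulus_ge0 z : 0 <= modulus z.
Proof. by case: z => x y; exact: sqrtr_ge0. Qed.

Lemma sqr_modulus (x y : R) : modulus (x +i* y) ^+ 2 = x ^+ 2 + y ^+ 2.
Proof. by rewrite /modulus /= sqr_sqrtr // addr_ge0 ?sqr_ge0. Qed.

Lemma le_modulusD z1 z2 : modulus (z1 + z2) <= modulus z1 + modulus z2.
Proof. by rewrite -lecR rmorphD /= !modulus_norm ler_normD. Qed.

Lemma modulusBC z1 z2 : modulus (z1 - z2) = modulus (z2 - z1).
Proof. by apply: complexI; rewrite /= !modulus_norm distrC. Qed.

(* Ellipses and hyperbolas have the same equation once the radicals are removed: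
   its left-hand side is the product of the four expressions [l +- |z - a1| +- |z - a2|]. *)
Lemma central_conic_equation (D : set R[i]) a1 a2 : central_conic D a1 a2 ->
  exists l : R, [/\ 0 < l, l ^+ 2 != modulus (a1 - a2) ^+ 2 &
    forall z, D z <->
      (modulus (z - a1) ^+ 2 - modulus (z - a2) ^+ 2) ^+ 2
        - 2 * l ^+ 2 * (modulus (z - a1) ^+ 2 + modulus (z - a2) ^+ 2) + l ^+ 4 = 0].
Proof.
(* The triangle inequalities exclude the factors belonging to a conic of the other kind. *)
have tri z : modulus (a1 - a2) <= modulus (z - a1) + modulus (z - a2).
  by rewrite (modulusBC z a1) -[a1 - a2](subrKA z); exact: le_modulusD.
have tri1 z : modulus (z - a1) <= modulus (z - a2) + modulus (a1 - a2).
  by rewrite (modulusBC a1 a2) -[z - a1](subrKA a2); exact: le_modulusD.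
have tri2 z : modulus (z - a2) <= modulus (z - a1) + modulus (a1 - a2).
  by rewrite -[z - a2](subrKA a1); exact: le_modulusD.
have E (p q l : R) : (p ^+ 2 - q ^+ 2) ^+ 2 - 2 * l ^+ 2 * (p ^+ 2 + q ^+ 2) + l ^+ 4
   = (p + q - l) * (p + q + l) * (p - q - l) * (p - q + l) by ring.
have c0 := modulus_ge0 (a1 - a2).
case=> [[l [cl ->]]|[l [/andP[l0 lc] ->]]]; exists l.
  have l0 : 0 < l := le_lt_trans c0 cl.
  split=> //; first by apply: contraTneq cl => /eqP; rewrite eqrXn2 ?c0 ?(ltW l0) // => /eqP ->; rewrite ltxx.
  move=> z; rewrite E /=; have := (tri1 z, tri2 z, modulus_ge0 (z - a1), modulus_ge0 (z - a2)).
  move: (modulus (z - a1)) (modulus (z - a2)) => p q [[[t1 t2] p0] q0].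
  split=> [->|]; first by rewrite subrr !mul0r.
  by move/eqP; rewrite !mulf_eq0 -!orbA => /or4P[] /eqP; lra.
split=> //; first by apply: contraTneq lc => /eqP; rewrite eqrXn2 ?c0 ?(ltW l0) // => /eqP ->; rewrite ltxx.
move=> z; rewrite E /=; have := (tri z, modulus_ge0 (z - a1), modulus_ge0 (z - a2)).
move: (modulus (z - a1)) (modulus (z - a2)) => p q [[t1 p0] q0].
split=> [/eqP|].
  by rewrite eqr_norml => /andP[/orP[] /eqP pq _]; rewrite pq ?addNr ?subrr ?mulr0 ?mul0r.
move/eqP; rewrite !mulf_eq0 -!orbA => /or4P[] /eqP H; try lra.
  by rewrite (_ : p - q = l) ?gtr0_norm; lra.
by rewrite (_ : p - q = - l) ?normrN ?gtr0_norm; lra.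
Qed.

Lemma line_reparam p d (t0 k : R) : k != 0 ->
  line (p + t0%:C * d) (k%:C * d) = line p d.
Proof.
move=> k0; apply/seteqP; split=> z [t ->] /=.
  by exists (t0 + t * k); rewrite rmorphD rmorphM /=; ring.
exists ((t - t0) / k); rewrite -addrA; congr (_ + _).
rewrite mulrA -rmorphM /= mulfVK // rmorphB /=; ring.
Qed.

(* The conic with center [(mx, my)], foci [(mx, my) +- (fx, fy)] and [2a = l]. *)
Section CenteredConic.
Variables (mx my fx fy l : R).
Implicit Types x y u w : R.
Let kap := l ^+ 2 * (l ^+ 2 - 4 * (fx ^+ 2 + fy ^+ 2)).
Let Q x y := 16 * (fx * x + fy * y) ^+ 2 - 4 * l ^+ 2 * (x ^+ 2 + y ^+ 2).
Let B x y u w := 16 * (fx * x + fy * y) * (fx * u + fy * w) - 4 * l ^+ 2 * (x * u + y * w).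
Variable D : set R[i].
Hypothesis kap0 : kap != 0.
Hypothesis DE : forall z, D z <-> Q (complex.Re z - mx) (complex.Im z - my) + kap = 0.

(** [B] is the polar form of [Q], and [16 * kap] is the determinant of [Q]. *)
Let gram x y u w : Q x y * Q u w - B x y u w ^+ 2 = 16 * kap * (x * w - y * u) ^+ 2.
Proof. by rewrite /Q /B /kap; ring. Qed.

(** At a contact point the direction is [B]-conjugate to the radius vector and [Q] equals [- kap],
    so [gram] yields the equation. Conversely, the conjugate point of the line lies on the conic by
    [gram], and a curve through it is written down. *)
Lemma tangent_line_centered (x1 y1 dx dy : R) :
  let X := (x1 - mx) * dy - (y1 - my) * dx in
  dx +i* dy != 0 ->
  tangent_line D (line (x1 +i* y1) (dx +i* dy)) <-> Q dx dy = - (16 * X ^+ 2) /\ X != 0.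
Proof.
move=> X d0; split.
  case=> g [[vx vy] [Dg [dRe dIm] v0 L]].
  have : line (g 0) (vx +i* vy) (g 0) by exists 0; rewrite mul0r addr0.
  rewrite -L => -[t0 gE].
  have : line (g 0) (vx +i* vy) (g 0 + (vx +i* vy)) by exists 1; rewrite mul1r.
  rewrite -L => -[t1]; rewrite gE -addrA => /addrI.
  move=> /(canRL (addKr _)); rewrite addrC -mulrBl -rmorphB /= => vE.
  set k := t1 - t0 in vE; move: vE; simpc => -[vxE vyE].
  have k0 : k != 0 by apply: contraNneq v0 => k0; rewrite vxE vyE k0 !mul0r.
  have [xE yE] : complex.Re (g 0) = x1 + t0 * dx /\ complex.Im (g 0) = y1 + t0 * dy.
    by rewrite gE; simpc.
  pose x := complex.Re (g 0) - mx; pose y := complex.Im (g 0) - my.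
  have Qxy : Q x y = - kap by move: (Dg 0) => /DE /eqP; rewrite addr_eq0 => /eqP.
  have Bv : B x y vx vy = 0.
    have h0 : (fun t => Q (complex.Re (g t) - mx) (complex.Im (g t) - my) + kap) = cst 0.
      by apply/funext => t; apply/DE.
    have : is_derive (0 : R) (1 : R) (fun t => Q (complex.Re (g t) - mx) (complex.Im (g t) - my) + kap) (2 * B x y vx vy).
      rewrite /Q; apply: is_derive_eq.
      by rewrite /GRing.scale /B -/x -/y /=; ring.
    rewrite h0 => /@derive_val; rewrite derive_cst => /esym/eqP.
    by rewrite mulf_eq0 pnatr_eq0 => /eqP.
  have Bd : B x y dx dy = 0.
    apply: (mulfI k0); rewrite mulr0 -Bv vxE vyE /B; ring.
  have XE : X = x * dy - y * dx by rewrite /X /x /y xE yE; ring.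
  have QX : Q dx dy = - (16 * X ^+ 2).
    apply: (mulfI kap0); have := gram x y dx dy; rewrite Bd Qxy XE; lra.
  split=> //;  apply: contra kap0 => /eqP X0.
  have nd : dx ^+ 2 + dy ^+ 2 != 0.
    apply: contraNneq d0 => /eqP; rewrite paddr_eq0 ?sqr_ge0 // !sqrf_eq0.
    by move=> /andP[/eqP -> /eqP ->].
  (* The radius vector is split along the direction and its normal. If [X = 0], only the first
     component remains, and [Q] vanishes on it. *)
  have : (dx ^+ 2 + dy ^+ 2) ^+ 2 * Q x y = 
     Q ((x * dx + y * dy) * dx + X * dy) ((x * dx + y * dy) * dy - X * dx).
    by rewrite XE /Q; ring.
  have -> : Q ((x * dx + y * dy) * dx + X * dy) ((x * dx + y * dy) * dy - X * dx) = 
     (x * dx + y * dy) ^+ 2 * Q dx dy + X * (2 * (x * dx + y * dy) * B dx dy dy (- dx)) + X ^+ 2 * Q dy (- dx).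
    by rewrite /Q /B; ring.
  rewrite QX X0 expr0n /= !mulr0 !mul0r !addr0 oppr0 mulr0 Qxy => /eqP.
  by rewrite mulf_eq0 sqrf_eq0 (negPf nd) oppr_eq0.
case=> QX X0; set q := Q dx dy in QX.
have q0 : q != 0 by rewrite QX oppr_eq0 mulf_neq0 ?sqrf_eq0 ?pnatr_eq0.
(* The point of the line whose radius vector is [B]-conjugate to the direction. *)
pose t0 := - B (x1 - mx) (y1 - my) dx dy / q.
pose x := x1 - mx + t0 * dx; pose y := y1 - my + t0 * dy.
have Bd : B x y dx dy = 0.
  transitivity (B (x1 - mx) (y1 - my) dx dy + t0 * q); first by rewrite /B /x /y /q /Q; ring.
  by rewrite /t0; field.
have XE : X = x * dy - y * dx by rewrite /X /x /y; ring.
have Qxy : Q x y = - kap.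
  apply: (mulIf q0); have := gram x y dx dy; rewrite Bd -XE -/q expr0n subr0 => ->.
  by rewrite QX; ring.
(* [W t] is the value of [Q] at [d + t * (x, y)], and [s t] is the nonzero root of the intersection
   equation. *)
pose W t := q - kap * t ^+ 2; pose s t := 2 * kap * t / W t.
pose g t := (mx + (x + s t * (dx + t * x))) +i* (my + (y + s t * (dy + t * y))).
(* [g t] is the second intersection of the conic with the line through [x], [y] of direction
   [d + t * (x, y)]; when [W t = 0] the junk value [s t = 0] gives the first one. *)
have s0 : s 0 = 0 by rewrite /s mulr0 mul0r.
have ds : is_derive (0 : R) (1 : R) s (2 * kap / q).
  have dW : is_derive (0 : R) (1 : R) W 0.
    rewrite /W; apply: is_derive_eq.
    by rewrite /GRing.scale /=; ring.
  have W0 : W 0 = q by rewrite /W expr0n /= mulr0 subr0.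
  have dWV : is_derive (0 : R) (1 : R) (fun t => (W t)^-1) (- (W 0) ^- 2 *: 0).
    by apply: is_deriveV; rewrite W0.
  rewrite /s; apply: is_derive_eq.
  by rewrite /GRing.scale /= W0 !mulr0 !add0r mulr1 mulrC.
have k0 : 2 * kap / q != 0.
  by apply: mulf_neq0; [apply: mulf_neq0; rewrite ?pnatr_eq0|rewrite invr_eq0].
have L : line (g 0) ((2 * kap / q)%:C * (dx +i* dy)) = line (x1 +i* y1) (dx +i* dy).
  rewrite -(line_reparam (x1 +i* y1) (dx +i* dy) t0 (k := 2 * kap / q)) //.
  congr (line _ _); rewrite /g s0 !mul0r !addr0 /x /y; simpc.
  by congr (_ +i* _); ring.
exists g, ((2 * kap / q)%:C * (dx +i* dy)); split=> //.
- move=> t; apply/DE; rewrite /g /=.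
  have -> : Q (mx + (x + s t * (dx + t * x)) - mx) (my + (y + s t * (dy + t * y)) - my)
    = (1 + s t * t) ^+ 2 * Q x y + 2 * s t * (1 + s t * t) * B x y dx dy + s t ^+ 2 * q.
    by rewrite /Q /B /q /Q; ring.
  rewrite Bd Qxy mulr0 addr0.
  have sW : s t * (s t * W t - 2 * kap * t) = 0.
    rewrite /s; have [->|W0] := eqVneq (W t) 0; first by rewrite invr0 !mulr0 !mul0r.
    by rewrite mulfVK // subrr mulr0.
  rewrite -[RHS]sW /W; ring.
- simpc; split => /=.
    apply: is_derive_eq.
    by rewrite /GRing.scale /= s0; ring.
  apply: is_derive_eq.
  by rewrite /GRing.scale /= s0; ring.
- by rewrite mulf_neq0 // fmorph_eq0.
Qed.
End CenteredConic.

(** Up to the factor [2i |d|], the signed distance from [a] to [line z d]. *)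
Definition cross a z d : R[i] := Num.conj d * (a - z) - d * Num.conj (a - z).

(** Classically, the product of the signed distances from the foci to a tangent is constant. Here
    [b = l^2 - |a1 - a2|^2] is four times that product, positive for an ellipse and negative for a
    hyperbola. *)
Lemma tangent_line_foci (D : set R[i]) a1 a2 : central_conic D a1 a2 ->
  exists2 b : R, b != 0 & forall z d, d != 0 ->
    tangent_line D (line z d) <->
      cross a1 z d * cross a2 z d = - b%:C * (d * Num.conj d) /\
      cross a1 z d + cross a2 z d != 0.
Proof.
case: a1 a2 => [a1x a1y] [a2x a2y] /central_conic_equation[l [l0 lc DE]].
exists (l ^+ 2 - modulus (a1x +i* a1y - (a2x +i* a2y)) ^+ 2); first by rewrite subr_eq0.
move: lc DE; simpc; rewrite sqr_modulus => lc DE [zx zy] [dx dy] d0.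
pose mx := (a1x + a2x) / 2; pose my := (a1y + a2y) / 2.
pose fx := (a1x - a2x) / 2; pose fy := (a1y - a2y) / 2.
have fE : 4 * (fx ^+ 2 + fy ^+ 2) = (a1x - a2x) ^+ 2 + (a1y - a2y) ^+ 2.
  by rewrite /fx /fy; field.
rewrite (tangent_line_centered (mx := mx) (my := my) (fx := fx) (fy := fy) (l := l)) //; first last.
- move=> [x y]; rewrite DE; simpc; rewrite !sqr_modulus.
  set p := (X in X = 0 <-> _); set q := (X in _ <-> X = 0).
  suff -> : p = q by [].
  by rewrite /p /q /= fE /mx /my /fx /fy; field.
- apply: mulf_neq0; first by rewrite sqrf_eq0 gt_eqF.
  by rewrite fE subr_eq0.
set X := (zx - mx) * dy - (zy - my) * dx.
have cE (ax ay : R) : cross (ax +i* ay) (zx +i* zy) (dx +i* dy) =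
    0 +i* (2 * (dx * (ay - zy) - dy * (ax - zx))).
  by rewrite /cross; simpc; congr (_ +i* _); ring.
rewrite !cE; simpc.
rewrite [X in _ /\ X *i != 0](_ : _ = 4 * X); last by rewrite /X /mx /my; field.
rewrite (_ : _ * (- (dx * dy) + dy * dx) = 0); last by ring.
have -> : (4 * X) *i != 0 :> R[i] = (X != 0).
  by rewrite eq_complex /= eqxx mulf_eq0 pnatr_eq0.
split=> -[E X0]; split=> //.
  congr (_ +i* _); apply: (mulfI (_ : 4 != 0)); first by rewrite pnatr_eq0.
  move: E; rewrite /X /fx /fy /mx /my; lra.
move: E => [E]; apply/eqP; rewrite -subr_eq0 opprK; apply/eqP.
rewrite -[RHS](mulr0 (- 4)) -[X in _ = _ * X](subrr (- (2 * (dx * (a1y - zy) - dy * (a1x - zx)) *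
   (2 * (dx * (a2y - zy) - dy * (a2x - zx)))))) {2}E /X /fx /fy /mx /my; by field.
Qed.

End Tangency.

(** * Poncelet families *)

Section Poncelet.
Variable R : realType.
Implicit Types (z c u v w a : R[i]) (r : R).

Lemma conj_real r : Num.conj r%:C = r%:C.
Proof. exact: conjc_real. Qed.

Lemma cross_chord c r a u v : `|u| = 1 -> `|v| = 1 ->
  cross (c + r%:C * a) (c + r%:C * u) (c + r%:C * v - (c + r%:C * u)) * (u * v) =
  - (r%:C ^+ 2 * (v - u) * chord a (Num.conj a) u v).
Proof.
move=> u1 v1; rewrite /cross /chord opprD addrACA subrr add0r -!mulrBr.
rewrite !(rmorphM, rmorphB, rmorphD) /= !conj_real (unit_conj u1) (unit_conj v1).
by field; rewrite !unit_neq0.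
Qed.

(** By [cross_chord] both [cross] values carry the same factor, whose square cancels against the
    squared length of the direction and leaves [k = b / r^2]. *)
Lemma tangent_line_circle (D : set R[i]) c r a1 a2 : r != 0 ->
  central_conic D (c + r%:C * a1) (c + r%:C * a2) ->
  exists2 k : R[i], k != 0 & forall u v, `|u| = 1 -> `|v| = 1 -> u != v ->
    tangent_line D (line (c + r%:C * u) (c + r%:C * v - (c + r%:C * u))) <->
    tangent_chord k a1 a2 u v.
Proof.
move=> r0 /tangent_line_foci[b b0 tD].
have rC : r%:C != 0 :> R[i] by rewrite fmorph_eq0.
exists (b%:C / r%:C ^+ 2).
  by rewrite mulf_neq0 ?invr_eq0 ?expf_neq0 ?fmorph_eq0.
move=> u v u1 v1 uv.
have [u0 v0] := (unit_neq0 u1, unit_neq0 v1).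
have vu0 : v - u != 0 by rewrite subr_eq0 eq_sym.
rewrite tD; last by rewrite opprD addrACA subrr add0r -mulrBr mulf_neq0.
rewrite /tangent_chord.
have cE a : cross (c + r%:C * a) (c + r%:C * u) (c + r%:C * v - (c + r%:C * u)) =
    - (r%:C ^+ 2 * (v - u) / (u * v)) * chord a (Num.conj a) u v.
  by apply: (mulIf (mulf_neq0 u0 v0)); rewrite cross_chord //; field; rewrite u0 v0.
rewrite !cE -mulrDr; set G1 := chord a1 _ u v; set G2 := chord a2 _ u v.
have s0 : - (r%:C ^+ 2 * (v - u) / (u * v)) != 0.
  by rewrite oppr_eq0 !mulf_neq0 ?invr_eq0 ?mulf_neq0 ?expf_neq0.
have -> : c + r%:C * v - (c + r%:C * u) = r%:C * (v - u) by ring.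
have dd : r%:C * (v - u) * Num.conj (r%:C * (v - u)) = - (r%:C ^+ 2 * (v - u) ^+ 2 / (u * v)).
  rewrite !(rmorphM, rmorphB) /= conj_real (unit_conj u1) (unit_conj v1).
  by field; rewrite u0 v0.
rewrite dd mulf_eq0 (negPf s0) /=.
split=> -[E G0]; split=> //.
  apply: (mulfI (expf_neq0 2 s0)); rewrite expr2 mulrACA E; field.
  by rewrite u0 v0 rC.
rewrite mulrACA E; field.
by rewrite u0 v0 rC.
Qed.

Lemma noncollinear_distinct z1 z2 z3 : ~ collinear z1 z2 z3 ->
  [/\ z1 != z2, z2 != z3 & z3 != z1].
Proof.
have l0 p v : line p v p by exists 0; rewrite mul0r addr0.
have l1 (p q : R[i]) : line p (q - p) q by exists 1; rewrite mul1r subrKC.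
move=> nc; split; apply/negP => /eqP e; apply: nc.
- by exists z1, (z3 - z1); rewrite -e.
- by exists z2, (z1 - z2); rewrite -e.
- by exists z1, (z2 - z1); rewrite e.
Qed.

(** Collinearity makes the ratio of [v - u] and [w - u] real; replacing conjugates by inverses turns
    this into the vanishing of the product of the differences. *)
Lemma unit_noncollinear c r u v w : r != 0 -> `|u| = 1 -> `|v| = 1 -> `|w| = 1 ->
  u != v -> v != w -> w != u ->
  ~ collinear (c + r%:C * u) (c + r%:C * v) (c + r%:C * w).
Proof.
move=> r0 u1 v1 w1 uv vw wu [p [d [[t1 e1] [t2 e2] [t3 e3]]]].
have rC : r%:C != 0 :> R[i] by rewrite fmorph_eq0.
have [[u0 v0] w0] := (unit_neq0 u1, unit_neq0 v1, unit_neq0 w1).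
have vE : r%:C * (v - u) = (t2 - t1)%:C * d.
  transitivity ((p + t2%:C * d) - (p + t1%:C * d)); first by rewrite -e1 -e2; ring.
  by rewrite rmorphB /=; ring.
have wE : r%:C * (w - u) = (t3 - t1)%:C * d.
  transitivity ((p + t3%:C * d) - (p + t1%:C * d)); first by rewrite -e1 -e3; ring.
  by rewrite rmorphB /=; ring.
have E : r%:C * (v - u) * Num.conj (r%:C * (w - u)) = Num.conj (r%:C * (v - u)) * (r%:C * (w - u)).
  by rewrite vE wE !rmorphM /= !conj_real; ring.
move: E; rewrite !(rmorphM, rmorphB) /= conj_real (unit_conj u1) (unit_conj v1) (unit_conj w1) => E.
have : r%:C ^+ 2 * ((v - u) * (u - w) * (v - w)) = 0.
  transitivity ((r%:C * (v - u) * (r%:C * (w^-1 - u^-1)) - r%:C * (v^-1 - u^-1) * (r%:C * (w - u))) * (u * v * w)).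
    by field; rewrite u0 v0 w0.
  by rewrite E subrr mul0r.
apply/eqP; rewrite !mulf_neq0 ?expf_neq0 ?subr_eq0 //; by rewrite eq_sym.
Qed.

Lemma circleE c r u : 0 < r -> circle c r (c + r%:C * u) <-> `|u| = 1.
Proof.
move=> r0; rewrite /circle /= addrC addKr.
have rE : modulus (r%:C * u) = r * modulus u.
  rewrite /modulus ComplexField.Normc.normcM /=.
  by rewrite expr0n addr0 sqrtr_sqr gtr0_norm.
rewrite rE; split=> [|u1].
  move=> /(canRL (mulKf (lt0r_neq0 r0))); rewrite mulVf ?gt_eqF // => u1.
  by rewrite -modulus_norm u1.
suff -> : modulus u = 1 by rewrite mulr1.
by apply: complexI; rewrite /= modulus_norm u1.
Qed.

Lemma poncelet_family_unit (D : set R[i]) c r a1 a2 : 0 < r ->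
  central_conic D (c + r%:C * a1) (c + r%:C * a2) ->
  exists2 k : R[i], k != 0 & forall u v w,
    poncelet_family (circle c r) D (c + r%:C * u, c + r%:C * v, c + r%:C * w) <->
    unit_triangle k a1 a2 u v w.
Proof.
move=> r0 cD; have rn0 := lt0r_neq0 r0.
have rC : r%:C != 0 :> R[i] by rewrite fmorph_eq0.
have [k k0 tD] := tangent_line_circle rn0 cD.
exists k => // u v w; split.
  case=> /noncollinear_distinct[uv vw wu] [/circleE u1 /circleE v1 /circleE w1] [tuv tvw twu].
  have inj x y : c + r%:C * x != c + r%:C * y -> x != y by apply: contraNneq => ->.
  have [[{}uv {}vw] {}wu] := (inj _ _ uv, inj _ _ vw, inj _ _ wu).
  have {}u1 := u1 r0; have {}v1 := v1 r0; have {}w1 := w1 r0.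
  by split; [split|split|apply/tD|apply/tD|apply/tD].
case=> [[u1 v1 w1] [uv vw wu] tuv tvw twu]; split.
- exact: unit_noncollinear.
- by split; apply/circleE.
- by split; apply/tD.
Qed.

Lemma sqr_modulusC z : (modulus z ^+ 2)%:C = z * Num.conj z.
Proof. by rewrite rmorphXn /= modulus_norm normCK. Qed.

(** With [s] the sum of the unit vertices, the median from [x] is [r (3x - s) / 2], and the three
    [|3x - s|^2] add up to [27 - 3 |s|^2]. *)
Lemma total_power_area_unit c r u v w : `|u| = 1 -> `|v| = 1 -> `|w| = 1 ->
  total_power_area (c + r%:C * u, c + r%:C * v, c + r%:C * w) =
  (3 * pi / 4 * (r ^+ 2 * (9 - modulus (u + v + w) ^+ 2)))%:E.
Proof.
move=> u1 v1 w1; rewrite /total_power_area /power_disk !area_disk ?modulus_ge0 //.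
rewrite -!EFinD -!mulrDr; congr EFin.
rewrite [3 * pi]mulrC -!mulrA; congr (_ * _).
have m x y z : c + r%:C * x - midpoint (c + r%:C * y) (c + r%:C * z) =
    r%:C * (3 * x - (x + y + z)) / 2 by rewrite /midpoint; field.
have e x y z := sqr_modulusC (c + r%:C * x - midpoint (c + r%:C * y) (c + r%:C * z)).
move: (e u v w) (e v w u) (e w u v) (sqr_modulusC (u + v + w)); rewrite !m.
move: (modulus _ ^+ 2) (modulus _ ^+ 2) (modulus _ ^+ 2) (modulus _ ^+ 2) => S W V U.
rewrite !(rmorphM, rmorphB, rmorphD, fmorphV, rmorph1) /= !conj_real.
rewrite (unit_conj u1) (unit_conj v1) (unit_conj w1) => eU eV eW eS.
apply: complexI; rewrite !(rmorphM, rmorphB, rmorphD, fmorphV, rmorph1) /= eU eV eW eS.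
by field; rewrite !unit_neq0.
Qed.


Lemma unit_triangle_norm_sum_center (k a1 a2 u v w : R[i]) : k != 0 ->
  unit_triangle k a1 a2 u v w -> a1 + a2 = 0 -> `|u + v + w| = `|a1| ^+ 2.
Proof.
move=> k0 T /eqP; rewrite addrC addr_eq0 => /eqP a2E.
have [-> _ _ _] := unit_triangle_vieta k0 T; case: T => [[u1 v1 w1] _ _ _ _].
rewrite a2E subrr add0r rmorphN mulrN normrM normrN !normrM u1 v1 w1 !norm_conjC.
by rewrite !mul1r.
Qed.

Lemma unit_triangle_norm_sum_focus (k a1 a2 u v w : R[i]) : k != 0 ->
  unit_triangle k a1 a2 u v w -> a2 = 0 -> `|u + v + w| = `|a1|.
Proof.
move=> k0 T a20; have [-> _ _ _] := unit_triangle_vieta k0 T.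
by rewrite a20 conjC0 !mulr0 !addr0.
Qed.

Lemma unit_triangle_swap_foci (k a1 a2 u v w : R[i]) :
  unit_triangle k a1 a2 u v w -> unit_triangle k a2 a1 u v w.
Proof.
have sw x y : tangent_chord k a1 a2 x y -> tangent_chord k a2 a1 x y.
  by rewrite /tangent_chord mulrC addrC.
by case=> ? ? ? ? ?; split=> //; exact: sw.
Qed.

End Poncelet.

Theorem theorem4p2 (R : realType) :
  (forall (c : R[i]) (r : R) (D : set R[i]) (a1 a2 : R[i]),
     0 < r -> central_conic D a1 a2 ->
     poncelet_family (circle c r) D !=set0 ->
     ((forall T T' : triangle,
         poncelet_family (circle c r) D T ->
         poncelet_family (circle c r) D T' ->
         total_power_area T = total_power_area T') <->
      c = conic_center a1 a2 \/ (c = a1 \/ c = a2)))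
  /\
  (forall (D : set R[i]) (a1 a2 : R[i]),
     central_conic D a1 a2 ->
     forall T : triangle, poncelet_family (circle 0 1) D T ->
       (0 = conic_center a1 a2 ->
          total_power_area T =
            (3 * pi / 4 * (9 - modulus a1 ^+ 4))%:E) /\
       (0 = a2 ->
          total_power_area T =
            (3 * pi / 4 * (9 - modulus a1 ^+ 2))%:E)).
Proof.
split.
  move=> c r D b1 b2 r0; have rC : r%:C != 0 :> R[i] by rewrite fmorph_eq0 gt_eqF.
  have normE z : c + r%:C * ((z - c) / r%:C) = z by rewrite mulrC divfK // subrKC.
  rewrite -(normE b1) -(normE b2).
  (* From here on [a1], [a2] are the foci in coordinates where the circumcircle is the unit
     circle. *)
  move: ((b1 - c) / _) ((b2 - c) / _) => a1 a2.
  move=> /(poncelet_family_unit r0)[k k0 H].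
  have HT T : poncelet_family (circle c r) D T -> exists u v w,
      T = (c + r%:C * u, c + r%:C * v, c + r%:C * w) /\ unit_triangle k a1 a2 u v w.
    case: T => [[x y] z] PT; exists ((x - c) / r%:C), ((y - c) / r%:C), ((z - c) / r%:C).
    by rewrite !normE; split=> //; apply/H; rewrite !normE.
  have centerE : c = conic_center (c + r%:C * a1) (c + r%:C * a2) <-> a1 + a2 = 0.
    have -> : conic_center (c + r%:C * a1) (c + r%:C * a2) = c + r%:C * (a1 + a2) / 2.
      by rewrite /conic_center /midpoint; field.
    split=> [|->]; last by rewrite mulr0 mul0r addr0.
    rewrite -{1}[c]addr0 => /addrI /esym/eqP.
    by rewrite !mulf_eq0 invr_eq0 pnatr_eq0 (negPf rC) orbF => /eqP.
  have focusE a : c = c + r%:C * a <-> a = 0.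
    split=> [|->]; last by rewrite mulr0 addr0.
    by rewrite -{1}[c]addr0 => /addrI /esym/eqP; rewrite mulf_eq0 (negPf rC) => /eqP.
  rewrite centerE !focusE => -[T0 /HT[x [y [z [_ xyz]]]]]; split; last first.
    move=> a12.
    have [n nE] : exists n, forall u v w, unit_triangle k a1 a2 u v w -> `|u + v + w| = n.
      case: a12 => [a12|[a10|a20]].
      - by exists (`|a1| ^+ 2) => u v w T; exact: unit_triangle_norm_sum_center T a12.
      - by exists `|a2| => u v w /unit_triangle_swap_foci T; exact: unit_triangle_norm_sum_focus T a10.
      - by exists `|a1| => u v w T; exact: unit_triangle_norm_sum_focus T a20.
    move=> _ _ /HT[u [v [w [-> T]]]] /HT[u' [v' [w' [-> T']]]].
    have [[u1 v1 w1] _ _ _ _] := T; have [[u1' v1' w1'] _ _ _ _] := T'.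
    rewrite !total_power_area_unit //.
    suff -> : modulus (u + v + w) = modulus (u' + v' + w') by [].
    by apply: complexI; rewrite /= !modulus_norm (nE _ _ _ T) (nE _ _ _ T').
  (* This product vanishes exactly in the three cases of the conclusion; otherwise a perturbed
     triangle contradicts constancy. *)
  move=> const; have [/eqP|K0] := eqVneq ((a1 + a2) * (a1 * a2)) 0.
    by rewrite !mulf_eq0 => /or3P[] /eqP; auto.
  have [u [v [w [uvw]]]] := unit_triangle_perturb k0 xyz K0.
  move/H: (uvw) => Pu; move/H: (xyz) => Px; have := const _ _ Pu Px.
  have [[u1 v1 w1] _ _ _ _] := uvw; have [[x1 y1 z1] _ _ _ _] := xyz.
  rewrite !total_power_area_unit // => -[].
  have pi3 : 3 * pi / 4 != 0 :> R by rewrite gt_eqF // divr_gt0 // mulr_gt0 // pi_gt0.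
  move=> /(mulfI pi3) /(mulfI (expf_neq0 2 (lt0r_neq0 r0))) /addrI /oppr_inj e.
  by rewrite -!modulus_norm -!rmorphXn /= e eqxx.
move=> D a1 a2 cD T PT.
have [k k0 H] : exists2 k : R[i], k != 0 & forall u v w,
    poncelet_family (circle 0 1) D (0 + 1%:C * u, 0 + 1%:C * v, 0 + 1%:C * w) <->
    unit_triangle k a1 a2 u v w.
  by apply: poncelet_family_unit; rewrite ?ltr01 // !mul1r !add0r.
case: T PT => [[u v] w] PT.
have uvw : unit_triangle k a1 a2 u v w by apply/H; rewrite !mul1r !add0r.
have [[u1 v1 w1] _ _ _ _] := uvw.
have -> : total_power_area (u, v, w) = (3 * pi / 4 * (9 - modulus (u + v + w) ^+ 2))%:E.
  have := total_power_area_unit 0 1 u1 v1 w1.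
  by rewrite !mul1r !add0r expr1n mul1r.
split=> [c0|a20].
  have a12 : a1 + a2 = 0.
    by apply/eqP; move/eqP: c0; rewrite eq_sym /conic_center /midpoint mulf_eq0 invr_eq0 pnatr_eq0 orbF.
  suff -> : modulus (u + v + w) = modulus a1 ^+ 2 by rewrite -exprM.
  by apply: complexI; rewrite rmorphXn /= !modulus_norm (unit_triangle_norm_sum_center k0 uvw).
suff -> : modulus (u + v + w) = modulus a1 by [].
by apply: complexI; rewrite /= !modulus_norm (unit_triangle_norm_sum_focus k0 uvw).
Qed.
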